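(* Let $(X,d)$ and $(X',d')$ be metric spaces. If $f:X\to X'$ is quasi-isometric, i.e. there exist $C\ge 1$ and $K\ge 0$ such that for all $x,y\in X$ $$\frac1C d(x,y)-K\le d'(f(x),f(y))\le C d(x,y)+K,$$ then $$\overline{\dim}_{\zeta} f(X)=\overline{\dim}_{\zeta} X,\qquad \underline{\dim}_{\zeta} f(X)=\underline{\dim}_{\zeta} X.$$
   Context: Let $(X,d)$ be a (nonempty) metric space and fix $\alpha\in X$. $B(\alpha,R)$ denotes the closed ball centered at $\alpha$ with radius $R>0$. For $E\subseteq X$ and $r>0$, $N(E,r)$ denotes the smallest number of sets of diameter at most $r$ required to cover $E$ ($N(E,r)=\infty$ if no finite such cover exists). Conventions for subsets of $[0,\infty)$: $\inf\emptyset=\infty$, $\sup\emptyset=0$, and $\sup A=\infty$ if $A$ is unbounded. For $F\subseteq X$, the upper zeta dimension is $$\overline{\dim}_{\zeta}F=\lim_{r\to\infty}\inf\Big\{\sigma\ge 0 : \exists C>0\ \exists R_0>0\ \forall R\ge R_0\ \ N\big(B(\alpha,R)\cap F,r\big)\le C R^{\sigma}\Big\},$$ and the lower zeta dimension is $$\underline{\dim}_{\zeta}F=\lim_{r\to\infty}\sup\Big\{\sigma\ge 0 : \exists C>0\ \exists R_0>0\ \forall R\ge R_0\ \ N\big(B(\alpha,R)\cap F,r\big)\ge C R^{\sigma}\Big\}.$$ The limits exist in $[0,\infty]$ and do not depend on $\alpha\in X$. The dimensions of $f(X)$ are those of $f(X)$ as a subset of $(X',d')$. *)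

(* Defs.v *)
From mathcomp Require Import all_boot all_order all_algebra.
From mathcomp Require Import all_classical all_reals all_analysis.

Set Implicit Arguments.
Unset Strict Implicit.
Unset Printing Implicit Defensive.

Import Order.TTheory GRing.Theory Num.Theory.
Import numFieldNormedType.Exports.

Local Open Scope classical_set_scope.
Local Open Scope ring_scope.

(* Supremum of a set of nonnegative extended reals, taken in [0, +oo]:
   unlike ereal_sup, it is 0 on the empty set. *)
Definition nneg_sup (R : realType) (A : set (\bar R)) : \bar R :=
  maxe 0%E (ereal_sup A).

Definition diameter (R : realType) (X : metricType R) (A : set X) : \bar R :=
  nneg_sup [set (mdist x y)%:E | x in A & y in A].

(* The library's closed_ball is the closure of the open ball, which in a
   general metric space can be smaller than this set. *)
Definition mclosed_ball (R : realType) (X : metricType R) (a : X) (rho : R) :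
  set X := [set x | mdist a x <= rho].

(* E can be covered by n sets of diameter at most r; repetitions and empty sets
   among the A i are harmless for the minimal such n. *)
Definition coverable (R : realType) (X : metricType R) (E : set X) (r : R)
    (n : nat) : Prop :=
  exists A : 'I_n -> set X,
    (forall i, (diameter (A i) <= r%:E)%E) /\ E `<=` \bigcup_i A i.

(* An infimum of natural numbers, hence attained unless there is no finite
   cover, in which case it is +oo. *)
Definition covering_number (R : realType) (X : metricType R) (E : set X)
    (r : R) : \bar R :=
  ereal_inf [set n%:R%:E | n in coverable E r].

Definition upper_growth_exponents (R : realType) (X : metricType R) (a : X)
    (F : set X) (r : R) : set R :=
  [set sigma | 0 <= sigma /\
    exists2 C : R, 0 < C & exists2 rho0 : R, 0 < rho0 &
      forall rho : R, rho0 <= rho ->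
        (covering_number (mclosed_ball a rho `&` F) r
           <= (C * rho `^ sigma)%:E)%E].

Definition lower_growth_exponents (R : realType) (X : metricType R) (a : X)
    (F : set X) (r : R) : set R :=
  [set sigma | 0 <= sigma /\
    exists2 C : R, 0 < C & exists2 rho0 : R, 0 < rho0 &
      forall rho : R, rho0 <= rho ->
        ((C * rho `^ sigma)%:E
           <= covering_number (mclosed_ball a rho `&` F) r)%E].

Definition upper_growth (R : realType) (X : metricType R) (a : X) (F : set X)
    (r : R) : \bar R :=
  ereal_inf (EFin @` upper_growth_exponents a F r).

Definition lower_growth (R : realType) (X : metricType R) (a : X) (F : set X)
    (r : R) : \bar R :=
  nneg_sup (EFin @` lower_growth_exponents a F r).

Definition upper_zeta_dim (R : realType) (X : metricType R) (a : X)
    (F : set X) : \bar R :=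
  lim (upper_growth a F r @[r --> +oo%R]).

Definition lower_zeta_dim (R : realType) (X : metricType R) (a : X)
    (F : set X) : \bar R :=
  lim (lower_growth a F r @[r --> +oo%R]).

Definition quasi_isometric (R : realType) (X X' : metricType R)
    (f : X -> X') : Prop :=
  exists C K : R, [/\ 1 <= C, 0 <= K &
    forall x y : X,
      C^-1 * mdist x y - K <= mdist (f x) (f y) <= C * mdist x y + K].

(* Both limits exist, so [lim] never takes its default value above. *)

Lemma covering_number_nonincreasing (R : realType) (X : metricType R)
    (E : set X) (r s : R) : r <= s ->
  (covering_number E s <= covering_number E r)%E.
Proof.
move=> rs; apply: ereal_inf_le_tmp => _ [n [A [dA EA]] <-]; exists n => //.
by exists A; split=> // i; apply: le_trans (dA i) _; rewrite lee_fin.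
Qed.

Lemma upper_growth_nonincreasing (R : realType) (X : metricType R) (a : X)
    (F : set X) (r s : R) : r <= s ->
  (upper_growth a F s <= upper_growth a F r)%E.
Proof.
move=> rs; apply: ereal_inf_le_tmp => _ [t [t0 [C C0 [p p0 H]]] <-]; exists t => //.
split=> //; exists C => //; exists p => // q pq.
exact: le_trans (covering_number_nonincreasing _ rs) (H _ pq).
Qed.

Lemma lower_growth_nonincreasing (R : realType) (X : metricType R) (a : X)
    (F : set X) (r s : R) : r <= s ->
  (lower_growth a F s <= lower_growth a F r)%E.
Proof.
move=> rs; rewrite /lower_growth /nneg_sup ge_max le_max lexx /= le_max.
apply/orP; right.
apply: ereal_sup_le => _ [t [t0 [C C0 [p p0 H]]] <-]; exists t => //.
split=> //; exists C => //; exists p => // q pq.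
exact: le_trans (H _ pq) (covering_number_nonincreasing _ rs).
Qed.

Lemma is_cvg_upper_growth (R : realType) (X : metricType R) (a : X)
    (F : set X) : cvg (upper_growth a F r @[r --> +oo%R]).
Proof.
apply/cvg_ex; eexists; apply: nonincreasing_cvge => r s.
exact: upper_growth_nonincreasing.
Qed.

Lemma is_cvg_lower_growth (R : realType) (X : metricType R) (a : X)
    (F : set X) : cvg (lower_growth a F r @[r --> +oo%R]).
Proof.
apply/cvg_ex; eexists; apply: nonincreasing_cvge => r s.
exact: lower_growth_nonincreasing.
Qed.

(* Main.v *)
Require Import Defs.
From mathcomp Require Import all_boot all_order all_algebra.
From mathcomp Require Import all_classical all_reals all_analysis.
From mathcomp Require Import lra.

Import Order.TTheory GRing.Theory Num.Theory.

Local Open Scope classical_set_scope.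
Local Open Scope ring_scope.

(** The graph of a quasi-isometry is a relation between [X] and [range f]
    along which distances agree up to an affine change, and this condition is
    symmetric in the two spaces.  It is therefore enough to show that such a
    relation makes the dimensions of one side at most those of the other, and
    to apply this to the graph of [f] and to its converse; no quasi-inverse of
    [f] has to be chosen.

    A relation of this kind carries a cover to a cover by the same number of
    sets, of diameter at most [C * r + K] instead of [r], and the ball of
    radius [rho >= 1] on one side is reached from the ball of radius [L * rho]
    on the other, for a fixed [L] ([covering_number_ball_le]).  The factor [L]
    only changes the constant in front of [rho `^ sigma], so growth exponents
    at scale [r] on one side control those at scale [C * r + K] on the other
    ([upper_growth_le], [lower_growth_le]).  The loss of scale disappears in
    the limit: growth is nonincreasing in the scale, so each dimension is the
    infimum of the growths over all scales. *)

Lemma diameter_leP {R : realType} {X : metricType R} (A : set X) (r : R) :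
  (diameter A <= r%:E)%E <->
  0 <= r /\ forall x y, A x -> A y -> mdist x y <= r.
Proof.
rewrite /diameter /nneg_sup ge_max lee_fin; split.
  move=> /andP[r0 Ar]; split=> // x y Ax Ay; rewrite -lee_fin.
  by apply: le_trans Ar; apply: ereal_sup_ubound; exists x => //; exists y.
move=> [-> Ar] /=; apply: ge_ereal_sup => _ [x Ax [y Ay <-]].
by rewrite lee_fin; exact: Ar.
Qed.

(** The sets of the new cover are the images of the old ones under [T]. *)
Lemma covering_number_relation_le {R : realType} {X X' : metricType R}
    (T : X -> X' -> Prop) (E : set X) (E' : set X') (r s : R) :
  (0 <= r -> 0 <= s) ->
  (forall x y x' y', T x x' -> T y y' ->
    mdist x y <= r -> mdist x' y' <= s) ->
  (forall x', E' x' -> exists2 x, E x & T x x') ->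
  (covering_number E' s <= covering_number E r)%E.
Proof.
move=> rs Trs EE'; apply: ereal_inf_le_tmp => _ [n [A [dA EA]] <-].
exists n => //; exists (fun i => [set x' | exists2 x, A i x & T x x']); split.
  move=> i; have /diameter_leP[r0 Ar] := dA i.
  apply/diameter_leP; split; first exact: rs.
  by move=> x' y' [x Ax Tx] [y Ay Ty]; apply: (Trs x y) => //; exact: Ar.
move=> x' /EE'[x /EA[i _ Aix] Tx]; by exists i => //; exists x.
Qed.

(** The base points need not be related: with [T b b'], a point of the ball
    around [a'] is related to a point at distance at most
    [mdist a b + C * (rho + mdist a' b') + K] from [a], and [1 <= rho] lets the
    additive constants be absorbed into the factor [L]. *)
Lemma covering_number_ball_le {R : realType} {X X' : metricType R}
    (T : X -> X' -> Prop) (F : set X) (F' : set X') (a b : X) (a' b' : X')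
    (C K : R) : 1 <= C -> 0 <= K ->
  (forall x y x' y', T x x' -> T y y' ->
    mdist x' y' <= C * mdist x y + K /\ mdist x y <= C * mdist x' y' + K) ->
  (forall x', F' x' -> exists2 x, F x & T x x') -> T b b' ->
  exists2 L : R, 0 < L & forall r rho : R, 1 <= rho ->
    (covering_number (mclosed_ball a' rho `&` F') (C * r + K)
     <= covering_number (mclosed_ball a (L * rho) `&` F) r)%E.
Proof.
move=> C1 K0 TC FF' Tb.
have D0 := mdist_ge0 a b; have D0' := mdist_ge0 a' b'.
have CD : 0 <= C * mdist a' b' by rewrite mulr_ge0 //; lra.
exists (mdist a b + C * (1 + mdist a' b') + K); first by lra.
move=> r rho rho1.
apply: (@covering_number_relation_le _ _ _ T).
- by move=> r0; rewrite addr_ge0 ?mulr_ge0 //; lra.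
- move=> x y x' y' Tx Ty xyr; have [xy' _] := TC _ _ _ _ Tx Ty.
  by nra.
- move=> x' [ax' /FF'[x Fx Tx]]; exists x => //; split=> //.
  rewrite /mclosed_ball /= in ax' *.
  have [_ bx] := TC _ _ _ _ Tb Tx.
  have ax := metric_triangle a b x.
  have := metric_triangle b' a' x'; rewrite (metric_sym b' a') => bx'.
  have CB : C * mdist b' x' <= C * (mdist a' b' + rho).
    by rewrite ler_pM2l; lra.
  have H : mdist a b + C * mdist a' b' + K
           <= (mdist a b + C * mdist a' b' + K) * rho.
    by rewrite ler_peMr //; lra.
  lra.
Qed.

Lemma upper_growth_le {R : realType} {X X' : metricType R} {a : X} {a' : X'}
    {F : set X} {F' : set X'} {r s L : R} : 0 < L ->
  (forall rho : R, 1 <= rho ->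
    (covering_number (mclosed_ball a' rho `&` F') s
     <= covering_number (mclosed_ball a (L * rho) `&` F) r)%E) ->
  (upper_growth a' F' s <= upper_growth a F r)%E.
Proof.
move=> L0 ball_le.
apply: ereal_inf_le_tmp => _ [t [t0 [C C0 [p p0 H]]] <-]; exists t => //.
split=> //; exists (C * L `^ t); first by rewrite mulr_gt0 ?powR_gt0.
exists (Num.max 1 (p / L)); first by rewrite lt_max ltr01.
move=> q; rewrite ge_max => /andP[q1 pq].
apply: le_trans (ball_le _ q1) _.
rewrite -mulrA -powRM; [|exact: ltW|by lra].
by apply: H; rewrite mulrC -ler_pdivrMr.
Qed.

Lemma lower_growth_le {R : realType} {X X' : metricType R} {a : X} {a' : X'}
    {F : set X} {F' : set X'} {r s L : R} : 0 < L ->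
  (forall rho : R, 1 <= rho ->
    (covering_number (mclosed_ball a' rho `&` F') s
     <= covering_number (mclosed_ball a (L * rho) `&` F) r)%E) ->
  (lower_growth a' F' s <= lower_growth a F r)%E.
Proof.
move=> L0 ball_le; rewrite /lower_growth /nneg_sup ge_max le_max lexx /= le_max.
apply/orP; right.
apply: ereal_sup_le => _ [t [t0 [C C0 [p p0 H]]] <-]; exists t => //.
split=> //; exists (C * L^-1 `^ t); first by rewrite mulr_gt0 ?powR_gt0 ?invr_gt0.
exists (L * Num.max 1 p); first by rewrite mulr_gt0 // lt_max ltr01.
move=> q; rewrite mulrC -ler_pdivlMr // ge_max => /andP[q1 pq].
have -> : q = L * (q / L) by rewrite mulrC divfK // gt_eqF.
apply: le_trans (ball_le _ q1).
rewrite -mulrA -powRM.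
- by rewrite mulKf ?gt_eqF //; exact: H.
- by rewrite invr_ge0 ltW.
- by rewrite mulr_ge0 ?ltW // (lt_le_trans ltr01).
Qed.

Lemma upper_zeta_dimE {R : realType} {X : metricType R} (a : X) (F : set X) :
  upper_zeta_dim a F = ereal_inf (range (upper_growth a F)).
Proof.
apply: cvg_lim; first exact: ereal_hausdorff.
by apply: nonincreasing_cvge => r s; exact: upper_growth_nonincreasing.
Qed.

Lemma lower_zeta_dimE {R : realType} {X : metricType R} (a : X) (F : set X) :
  lower_zeta_dim a F = ereal_inf (range (lower_growth a F)).
Proof.
apply: cvg_lim; first exact: ereal_hausdorff.
by apply: nonincreasing_cvge => r s; exact: lower_growth_nonincreasing.
Qed.

(** The hypothesis on distances is symmetric under exchanging the two spaces,
    so that the opposite inequalities follow from the converse relation. *)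
Lemma zeta_dim_relation_le {R : realType} {X X' : metricType R}
    (T : X -> X' -> Prop) (F : set X) (F' : set X') (a b : X) (a' b' : X')
    (C K : R) : 1 <= C -> 0 <= K ->
  (forall x y x' y', T x x' -> T y y' ->
    mdist x' y' <= C * mdist x y + K /\ mdist x y <= C * mdist x' y' + K) ->
  (forall x', F' x' -> exists2 x, F x & T x x') -> T b b' ->
  (upper_zeta_dim a' F' <= upper_zeta_dim a F)%E /\
  (lower_zeta_dim a' F' <= lower_zeta_dim a F)%E.
Proof.
move=> C1 K0 TC FF' Tb.
have [L L0 NL] := covering_number_ball_le T F F' a b a' b' C K C1 K0 TC FF' Tb.
rewrite !upper_zeta_dimE !lower_zeta_dimE.
split; apply/ereal_infP => _ [r _ <-]; apply: ge_ereal_inf.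
- exists (upper_growth a' F' (C * r + K)); first by exists (C * r + K).
  exact: (upper_growth_le L0 (NL r)).
- exists (lower_growth a' F' (C * r + K)); first by exists (C * r + K).
  exact: (lower_growth_le L0 (NL r)).
Qed.

Theorem theorem1p3 (R : realType) (X X' : metricType R) (f : X -> X')
    (hf : quasi_isometric f) (a : X) (a' : X') :
  upper_zeta_dim a' (range f) = upper_zeta_dim a [set: X] /\
  lower_zeta_dim a' (range f) = lower_zeta_dim a [set: X].
Proof.
have [C [K [C1 K0 fCK]]] := hf.
have C0 : 0 < C by lra.
have KCK : K <= C * K by rewrite ler_peMl.
have CK0 : 0 <= C * K by lra.
have fwd x y : mdist (f x) (f y) <= C * mdist x y + C * K.
  by have /andP[_ h] := fCK x y; lra.
(* Clearing [C^-1] multiplies the additive constant by [C], hence [C * K]. *)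
have bwd x y : mdist x y <= C * mdist (f x) (f y) + C * K.
  have /andP[+ _] := fCK x y.
  by rewrite lerBlDr mulrC ler_pdivrMr // mulrC mulrDr.
have [u l] : (upper_zeta_dim a' (range f) <= upper_zeta_dim a [set: X])%E /\
             (lower_zeta_dim a' (range f) <= lower_zeta_dim a [set: X])%E.
  apply: (zeta_dim_relation_le (fun x x' => f x = x') _ _ a a a' (f a)
            C (C * K)) => //.
  by move=> x y _ _ <- <-.
have [u' l'] : (upper_zeta_dim a [set: X] <= upper_zeta_dim a' (range f))%E /\
               (lower_zeta_dim a [set: X] <= lower_zeta_dim a' (range f))%E.
  apply: (zeta_dim_relation_le (fun x' x => f x = x') _ _ a' (f a) a a
            C (C * K)) => //.
    by move=> _ _ x y <- <-.
  by move=> x _; exists (f x) => //; exists x.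
split; apply/eqP; rewrite eq_le; first by rewrite u u'.
by rewrite l l'.
Qed.
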